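(* Let $(S,+,* )$ be a finite semiring with idempotent addition (that is, $a+a=a$ for all $a\in S$), let $\leq$ be the partial order on $S$ defined by $a\leq b$ if and only if $a+b=b$, and let $\infty:=\sum_{a\in S}a\in S$. Let $M$ be the set of minimal elements of $(S,\leq)$. Then $(S,+,* )$ is $k$-ideal-simple if and only if for all $x\in S\setminus(M\cup\{\infty\})$ we have $\infty*x\not\leq x$ or $x*\infty\not\leq x$.
   Context: A semiring here is a non-empty set $S$ with two binary operations $+$ and $*$ such that $(S,+)$ is associative and commutative and $a*(b+c)=a*b+a*c$, $(a+b)*c=a*c+b*c$ for all $a,b,c\in S$. The multiplication $*$ is not assumed to be associative or commutative. An ideal of $(S,+,* )$ is a non-empty subset $A\subseteq S$ such that $a+b\in A$ for all $a,b\in A$, and $s*a\in A$ and $a*s\in A$ for all $s\in S$, $a\in A$. A $k$-ideal is an ideal $A$ such that $a+y\in S\setminus A$ and $y+a\in S\setminus A$ for all $a\in A$ and $y\in S\setminus A$. The semiring is $k$-ideal-simple if it has no $k$-ideal $A$ with $A\neq S$ and $|A|\geq 2$. *)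

(* Defs.v *)
From mathcomp Require Import all_boot.
Set Implicit Arguments.
Unset Strict Implicit.
Unset Printing Implicit Defensive.

(* Multiplication is neither associative nor commutative in general, and no
   zero or unit is assumed, so none of the ssralg structures applies. *)
Record semiring (S : Type) (add mul : S -> S -> S) : Prop := Semiring {
  semiring_inhabited : inhabited S;
  semiring_addA : associative add;
  semiring_addC : commutative add;
  semiring_mulDr : right_distributive mul add;
  semiring_mulDl : left_distributive mul add
}.

Section FiniteSemiring.

Variables (S : finType) (add mul : S -> S -> S).

Definition ideal (A : {set S}) : Prop :=
  [/\ A != set0,
      forall a b, a \in A -> b \in A -> add a b \in A
    & forall s a, a \in A -> (mul s a \in A) /\ (mul a s \in A)].

Definition k_ideal (A : {set S}) : Prop :=
  ideal A /\
  (forall a y, a \in A -> y \in ~: A ->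
     (add a y \in ~: A) /\ (add y a \in ~: A)).

Definition k_ideal_simple : Prop :=
  ~ exists A : {set S}, [/\ k_ideal A, A != [set: S] & 2 <= #|A|].

Definition add_le : rel S := fun a b => add a b == b.

Definition minimal_elements : {set S} :=
  [set x | [forall y, add_le y x ==> (y == x)]].

(* There is no neutral element to start the sum from: it starts from an
   arbitrary x0 and runs over the other elements, so that every element of S,
   x0 included, is added exactly once. *)
Definition total_sum (x0 : S) : S := \big[add/x0]_(a : S | a != x0) a.

End FiniteSemiring.

(* Main.v *)
Require Import Defs.
From mathcomp Require Import all_boot.

(** In a finite additively idempotent semiring the k-ideals are principal
    down-sets: [A] is down-closed because [y <= a] means [y + a = a], and it is
    closed under sums, so the sum of all its elements is its greatest element.
    By monotonicity of the product, [{y | y <= x}] absorbs multiplication iff it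
    contains [oo * x] and [x * oo]; it is proper iff [x] is not [oo], and has at
    least two elements iff [x] is not minimal. *)

Section IdempotentSemiring.

Context {S : finType} {add mul : S -> S -> S}.
Hypothesis hS : semiring add mul.
Hypothesis add_idem : forall a : S, add a a = a.

Let addA : associative add := semiring_addA hS.
Let addC : commutative add := semiring_addC hS.

Lemma add_le_refl : reflexive (add_le add).
Proof. by move=> a; rewrite /add_le add_idem. Qed.

Lemma add_le_anti a b : add_le add a b -> add_le add b a -> a = b.
Proof. by move=> /eqP ab /eqP; rewrite addC ab. Qed.

Lemma add_le_trans {b a c} : add_le add a b -> add_le add b c -> add_le add a c.
Proof. by move=> /eqP ab /eqP bc; rewrite /add_le -bc addA ab. Qed.

Lemma add_le_addl a b : add_le add a (add a b).
Proof. by rewrite /add_le addA add_idem. Qed.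

Lemma add_le_addr a b : add_le add b (add a b).
Proof. by rewrite addC add_le_addl. Qed.

Lemma add_le_lub a b c :
  add_le add a c -> add_le add b c -> add_le add (add a b) c.
Proof. by move=> /eqP ac /eqP bc; rewrite /add_le -addA bc ac. Qed.

Lemma mul_monol {s a b} : add_le add a b -> add_le add (mul s a) (mul s b).
Proof. by move=> /eqP ab; rewrite /add_le -(semiring_mulDr hS) ab. Qed.

Lemma mul_monor {s a b} : add_le add a b -> add_le add (mul a s) (mul b s).
Proof. by move=> /eqP ab; rewrite /add_le -(semiring_mulDl hS) ab. Qed.

(** With no neutral element available, the starting value of the fold is itself a summand. This
    accounts for [x0] in [total_sum], whose index range omits it. *)
Lemma add_le_big_idx (x0 : S) (r : seq S) (P : pred S) :
  add_le add x0 (\big[add/x0]_(b <- r | P b) b).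
Proof.
elim: r => [|b r IH]; first by rewrite big_nil add_le_refl.
rewrite big_cons; case: (P b) => //.
exact: add_le_trans IH (add_le_addr _ _).
Qed.

Lemma add_le_big (x0 : S) (r : seq S) (P : pred S) a :
  a \in r -> P a -> add_le add a (\big[add/x0]_(b <- r | P b) b).
Proof.
move=> ar Pa; elim: r ar => // b r IH; rewrite inE big_cons.
case/orP => [/eqP <-|/IH le_a]; first by rewrite Pa add_le_addl.
by case: (P b) => //; apply: add_le_trans le_a (add_le_addr _ _).
Qed.

Lemma add_le_total_sum (x0 a : S) : add_le add a (total_sum add x0).
Proof.
have [->|ax0] := eqVneq a x0; first exact: add_le_big_idx.
by apply: add_le_big; rewrite ?mem_index_enum.
Qed.

Lemma minimal_elementsPn x :
  reflect (exists2 y, add_le add y x & y != x) (x \notin minimal_elements add).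
Proof.
rewrite inE negb_forall.
apply: (iffP existsP) => -[y]; first by rewrite negb_imply => /andP[]; exists y.
by move=> yx ynx; exists y; rewrite negb_imply yx.
Qed.

(** If [y] were outside [A], the k-condition would put [y + a] outside [A]; but [y + a = a]. *)
Lemma k_ideal_add_le {A a y} :
  k_ideal add mul A -> a \in A -> add_le add y a -> y \in A.
Proof.
move=> [_ kA] aA /eqP ya; apply/negPn/negP => yA.
by have [_] := kA a y aA (introT setCP (negP yA)); rewrite ya inE aA.
Qed.

Lemma k_ideal_greatest {A} :
  k_ideal add mul A -> exists2 x, x \in A & {in A, forall a, add_le add a x}.
Proof.
move=> [[/set0Pn[a0 a0A] addA_closed _] _].
(* The fold needs a starting value in [A]. Any member will do: [a0] then enters the sum twice,
   harmlessly, since addition is idempotent. *)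
exists (\big[add/a0]_(b in A) b); first exact: (big_ind (fun x => x \in A)).
by move=> a aA; apply: add_le_big; rewrite ?mem_index_enum.
Qed.

Lemma k_ideal_down (x0 x : S) :
  add_le add (mul (total_sum add x0) x) x ->
  add_le add (mul x (total_sum add x0)) x ->
  k_ideal add mul [set y | add_le add y x].
Proof.
move=> oox xoo; split; first split.
- by apply/set0Pn; exists x; rewrite inE add_le_refl.
- by move=> a b; rewrite !inE; exact: add_le_lub.
(* Two bounds on [x] control all products: [s * a <= oo * a <= oo * x <= x], and symmetrically on
   the right. *)
- move=> s a; rewrite !inE => ax; have s_oo := add_le_total_sum x0 s; split.
  + apply: add_le_trans oox.
    exact: add_le_trans (mul_monor s_oo) (mul_monol ax).
  + apply: add_le_trans xoo.
    exact: add_le_trans (mul_monol s_oo) (mul_monor ax).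
(* Since [y <= a + y], having [a + y <= x] would force [y <= x]. *)
- move=> a y _; rewrite !inE (addC y a) => yx.
  by split; apply: contra yx; exact/add_le_trans/add_le_addr.
Qed.

End IdempotentSemiring.

Theorem proposition4p11 (S : finType) (add mul : S -> S -> S)
    (hS : semiring add mul) (add_idem : forall a : S, add a a = a) (x0 : S) :
  let infty := total_sum add x0 in
  let M := minimal_elements add in
  k_ideal_simple add mul <->
  (forall x : S, x \in ~: (M :|: [set infty]) ->
     ~~ add_le add (mul infty x) x \/ ~~ add_le add (mul x infty) x).
Proof.
move=> infty M; have le_infty a := add_le_total_sum hS add_idem x0 a.
split=> [simple x | no_x [A [kA AnT A_gt1]]].
- rewrite inE in_setU negb_or in_set1 => /andP[/minimal_elementsPn[y yx ynx] xnoo].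
  apply/orP; rewrite -negb_and; apply/negP => /andP[oox xoo]; apply: simple.
  exists [set y | add_le add y x].
  split; first exact: (k_ideal_down hS add_idem x0).
  (* If the down-set were all of [S], it would contain [infty], so [infty <= x <= infty]. *)
  + apply: contra xnoo => /eqP/setP/(_ infty); rewrite !inE => oo_le_x.
    exact/eqP/(add_le_anti hS).
  + by apply/card_gt1P; exists y, x; rewrite !inE yx (add_le_refl add_idem).
- have [x xA A_le] := k_ideal_greatest hS add_idem kA.
  have absorb s : mul s x \in A /\ mul x s \in A.
    by case: kA => -[_ _ idA] _; apply: idA.
  (* Of two distinct members of [A], at least one differs from the greatest element [x], hence lies
     strictly below it. *)
  have xM : x \notin M.
    have /card_gt1P[a [b [aA bA anb]]] := A_gt1.
    apply/minimal_elementsPn; have [ax|anx] := eqVneq a x.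
      by exists b; rewrite ?A_le // -ax eq_sym.
    by exists a; rewrite ?A_le.
  have xnoo : x != infty.
    apply: contra AnT => /eqP x_oo; apply/eqP/setP => a; rewrite inE.
    by apply: (k_ideal_add_le kA xA); rewrite x_oo.
  (* Both alternatives fail: [infty * x] and [x * infty] lie in the ideal [A], hence below its
     greatest element [x]. *)
  have [] := no_x x; rewrite ?inE ?negb_or -?/M ?xnoo ?andbT.
  + by rewrite inE in xM.
  + by rewrite A_le //; case: (absorb infty).
  + by rewrite A_le //; case: (absorb infty).
Qed.
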